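(* Let $X$ be a nonempty convex compact metrizable subset of some Hausdorff locally convex topological vector space $S$. Let $K$ be any nonempty closed subset of $X$ (not necessarily convex). Then the following assertions hold. (1) $\emptyset\neq\mathrm{AExp}(K)\subset\mathrm{Ext}(K)$. (2) Let $I$ be a nonempty set and, for all $i\in I$, let $f_i:K\to\mathbb{R}$ be an upper semi-continuous $\mathrm{Aff}(X)$-convex function. Suppose that $\bigcap_{i\in I}K_{\max}(f_i)\neq\emptyset$. Then $$\mathrm{AExp}\Big(\bigcap_{i\in I}K_{\max}(f_i)\Big)\cap\mathrm{Ext}(K)\neq\emptyset.$$ In particular, there exists a common extremal point $e\in\mathrm{Ext}(K)$ at which $f_i$ attains its maximum on $K$, for each $i\in I$. (3) Let $\mathcal{B}$ be a subset of the set of all upper semi-continuous $\mathrm{Aff}(X)$-convex functions from $K$ into $\mathbb{R}$ which is $\mathrm{Aff}(X)$-stable. Then the set $$\mathcal{G}:=\{f\in\mathcal{B}:\ K_{\max}(f)\cap\mathrm{Ext}(K)\text{ is a singleton}\}$$ is a $G_\delta$ dense subset of $(\mathcal{B},\rho_\infty)$.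
   Context: $\mathrm{Aff}(X)$ is the space of all continuous affine functions $\varphi:X\to\mathbb{R}$, i.e. continuous with $\varphi(\lambda x+(1-\lambda)y)=\lambda\varphi(x)+(1-\lambda)\varphi(y)$ for all $x,y\in X$, $\lambda\in[0,1]$. For a nonempty subset $C$ of $X$ (not necessarily convex): a point $x\in C$ is extremal in $C$ if $y,z\in C$, $0<\alpha<1$ and $x=\alpha y+(1-\alpha)z$ imply $x=y=z$; $\mathrm{Ext}(C)$ is the set of extremal points of $C$. A point $x\in C$ is an affine exposed point of $C$ if there is $\varphi\in\mathrm{Aff}(X)$ whose restriction to $C$ attains its maximum uniquely at $x$, i.e. $\varphi(x)>\varphi(y)$ for all $y\in C\setminus\{x\}$; $\mathrm{AExp}(C)$ is the set of affine exposed points of $C$. (Sets are generally assumed to have at least two distinct points, the one-point case being trivial: the single point is then both exposed and extremal.) For $a,x,y\in K$, $a$ is $\mathrm{Aff}(X)$-between $x$ and $y$ if for every $\varphi\in\mathrm{Aff}(X)$, $\varphi(x)\le\varphi(a)$ and $\varphi(y)\le\varphi(a)$ imply $\varphi(a)=\varphi(x)=\varphi(y)$. A function $f:K\to\mathbb{R}$ is $\mathrm{Aff}(X)$-convex if for all $a,x,y\in K$ such that $a$ is $\mathrm{Aff}(X)$-between $x$ and $y$, $f(x)\le f(a)$ and $f(y)\le f(a)$ imply $f(x)=f(a)=f(y)$. A set $\mathcal{B}$ of real-valued functions on $K$ is $\mathrm{Aff}(X)$-stable if $f+\varphi_{|K}\in\mathcal{B}$ for all $f\in\mathcal{B}$ and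 $\varphi\in\mathrm{Aff}(X)$. For an upper semi-continuous $f:K\to\mathbb{R}$, $K_{\max}(f):=\{x\in K: f(x)=\max_K f\}$. The metric is $$\rho_\infty(f,g):=\sup_{x\in K}\frac{|f(x)-g(x)|}{1+|f(x)-g(x)|}.$$ *)

(* Defs.v *)
From HB Require Import structures.
From mathcomp Require Import all_boot all_order all_algebra.
From mathcomp Require Import all_classical all_reals all_analysis.

Set Implicit Arguments.
Unset Strict Implicit.
Unset Printing Implicit Defensive.

Import Order.TTheory GRing.Theory Num.Theory.
Import numFieldNormedType.Exports.

Local Open Scope classical_set_scope.
Local Open Scope ring_scope.

Definition metrizable (R : realType) (T : topologicalType) : Prop :=
  exists d : T -> T -> R,
    [/\ forall x y, d x y = 0 <-> x = y,
        forall x y, d x y = d y x,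
        forall x y z, d x z <= d x y + d y z &
        forall x : T, nbhs x = nbhs_ball_ (fun y e => [set z | d y z < e]) x].

Definition usc (R : realType) (T : topologicalType) (f : T -> R) : Prop :=
  forall (x : T) (a : R), f x < a -> \forall y \near x, f y < a.

(* A function X -> R is represented by any total function extending it:
   as long as C and K are contained in X, the notions below only evaluate
   elements of [Aff X] at points of X. *)
Definition Aff (R : realType) (S : tvsType R) (X : set S) : set (S -> R) :=
  [set phi | {within X, continuous phi} /\
     forall (x y : S) (l : R), X x -> X y -> 0 <= l <= 1 ->
       phi (l *: x + (1 - l) *: y) = l * phi x + (1 - l) * phi y].

Definition Ext (R : realType) (S : lmodType R) (C : set S) : set S :=
  [set x | C x /\
     forall (y z : S) (a : R), C y -> C z -> 0 < a < 1 ->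
       x = a *: y + (1 - a) *: z -> x = y /\ y = z].

Definition AExp (R : realType) (S : tvsType R) (X C : set S) : set S :=
  [set x | C x /\
     exists2 phi, Aff X phi & forall y, C y -> y <> x -> phi y < phi x].

Definition Aff_between (R : realType) (S : tvsType R) (X : set S)
    (a x y : S) : Prop :=
  forall phi, Aff X phi -> phi x <= phi a -> phi y <= phi a ->
    phi a = phi x /\ phi x = phi y.

Definition Aff_convex (R : realType) (S : tvsType R) (X K : set S)
    (f : K -> R) : Prop :=
  forall a x y : K, Aff_between X (set_val a) (set_val x) (set_val y) ->
    f x <= f a -> f y <= f a -> f x = f a /\ f a = f y.

Definition Kmax (R : realType) (S : Type) (K : set S) (f : K -> R) : set S :=
  set_val @` [set x : K | forall y : K, f y <= f x].

(* All real functions on T, as a metric space for the distance [rho_inf];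
   the alias avoids the product topology carried by [T -> R]. *)
Definition rho_fun (T : Type) (R : realType) : Type := T -> R.

HB.instance Definition _ (T : Type) (R : realType) :=
  Choice.copy (rho_fun T R) (T -> R).

Definition rho_inf (T : Type) (R : realType) (f g : rho_fun T R) : R :=
  sup [set `|f x - g x| / (1 + `|f x - g x|) | x in [set: T]].

Section rho_inf_metric.
Context {T : Type} {R : realType}.
Implicit Types f g h : rho_fun T R.

Let q (t : R) := t / (1 + t).

Let q_ge0 t : 0 <= t -> 0 <= q t.
Proof. by move=> t0; rewrite divr_ge0// addr_ge0. Qed.

Let q_le1 t : 0 <= t -> q t <= 1.
Proof. by move=> t0; rewrite ler_pdivrMr ?mul1r ?lerDr// ltr_wpDr. Qed.

Let q_le r s : 0 <= r -> r <= s -> q r <= q s.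
Proof.
move=> r0 rs; have s0 := le_trans r0 rs.
rewrite ler_pdivrMr ?ltr_wpDr// mulrAC ler_pdivlMr ?ltr_wpDr//.
by rewrite !mulrDr !mulr1 [s * r]mulrC lerD2r.
Qed.

Let q_triangle r s t : 0 <= r -> 0 <= s -> 0 <= t -> r <= s + t ->
  q r <= q s + q t.
Proof.
move=> r0 s0 t0 rst; apply: (le_trans (q_le r0 rst)).
rewrite {1}/q mulrDl; apply: lerD; rewrite ler_wpM2l// lef_pV2 ?posrE.
- by rewrite lerD2l lerDl.
- by rewrite ltr_wpDr// addr_ge0.
- by rewrite ltr_wpDr.
- by rewrite lerD2l lerDr.
- by rewrite ltr_wpDr// addr_ge0.
- by rewrite ltr_wpDr.
Qed.

Let q_has_ubound f g : has_ubound [set q `|f x - g x| | x in [set: T]].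
Proof. by exists 1 => _ [x _ <-]; exact: q_le1. Qed.

Lemma rho_inf_ub f g (x : T) :
  `|f x - g x| / (1 + `|f x - g x|) <= rho_inf f g.
Proof. by apply: (@ub_le_sup _ _ (q_has_ubound f g)); exists x. Qed.

Lemma rho_infxx f : rho_inf f f = 0.
Proof.
rewrite /rho_inf; under eq_imagel do rewrite subrr normr0 mul0r.
have [->|/set0P T0] := eqVneq [set: T] set0; first by rewrite image_set0 sup0.
by rewrite set_cst [_ == _](negPf _) ?sup1//; exact/set0P.
Qed.

Lemma rho_inf_positivity f g : rho_inf f g = 0 -> f = g.
Proof.
move=> fg0; apply/funext => x; apply/eqP; rewrite -subr_eq0 -normr_eq0.
have := rho_inf_ub f g x; rewrite fg0 ler_pdivrMr ?ltr_wpDr// mul0r => fg.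
by rewrite eq_le fg normr_ge0.
Qed.

Lemma rho_inf_sym f g : rho_inf f g = rho_inf g f.
Proof.
by congr sup; apply/seteqP; split => _ [x _ <-]; exists x => //; rewrite distrC.
Qed.

Lemma rho_inf_triangle g f h : rho_inf f h <= rho_inf f g + rho_inf g h.
Proof.
have [[x0]|T0] := pselect (inhabited T); last first.
  have eqf (u v : rho_fun T R) : u = v.
    by apply/funext => x; exfalso; apply: T0; exact: inhabits.
  by rewrite (eqf f g) (eqf h g) !rho_infxx addr0.
apply: ge_sup; first by exists (q `|f x0 - h x0|); exists x0.
move=> _ [x _ <-].
apply: (le_trans _ (lerD (rho_inf_ub f g x) (rho_inf_ub g h x))).
apply: q_triangle => //.
exact: ler_distD.
Qed.

HB.instance Definition _ := isMetric.Build R (rho_fun T R)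
  rho_infxx rho_inf_positivity rho_inf_sym rho_inf_triangle.

End rho_inf_metric.

(* Main.v *)
Require Import Defs.
From mathcomp Require Import all_boot all_order all_algebra.
From mathcomp Require Import all_classical all_reals all_analysis borel_hierarchy.
From mathcomp Require Import ring lra.
Import Order.TTheory GRing.Theory Num.Theory.
Import numFieldNormedType.Exports.
Local Open Scope classical_set_scope.
Local Open Scope ring_scope.

(** The set [Aff X] separates the points of [X] by Hahn-Banach, and, [X] being
    compact and metrizable, countably many of its members [phi n] are enough:
    at any two distinct points of [X], the values of some [phi n] differ by more
    than 1.  Everything rests on a perturbation principle: for an upper
    semicontinuous [f] on a nonempty compact [K `<=` X], an arbitrarily small
    [u] in [Aff X] makes [f + u] attain its maximum at exactly one point
    ([Aff_unique_max_perturbation]).  One member [phi] is dealt with by adding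
    a tiny positive multiple of it to [f]: among the maximizers of [f], this
    favours those where [phi] is largest, so that [phi] varies by at most 1 on
    the near-maximizers of the sum ([near_max_small_oscillation]).  As this
    survives any much smaller further perturbation, the [phi n] can be dealt
    with one after the other, and on the maximizers of the limit all of them
    vary by at most 1; so there is only one.

    Applied to [f = phi] on a compact [C], the principle gives affine exposed
    points of [C] at which [phi] is nearly maximal ([AExp_near_max]).  An
    exposed point is extremal by the definition of affine functions.  If [C] is
    a set of common maximizers of functions that are convex relative to
    [Aff X], then [C] is a face of [K]: when [e] in [C] is inside a segment
    with endpoints in [K], it is between these endpoints, which are therefore
    maximizers too.  Hence the exposed points of [C] are extremal in [K].

    For the last assertion, [Kmax f] meets [Ext K] in one point exactly when
    [Kmax f] is one point ([Kmax_Ext_singletonP]): if [Kmax f] had a further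
    point [y], some [phi] would be larger at [y] than at the extremal point
    [m], and an exposed point of [Kmax f] nearly maximizing [phi] would be
    another extremal point.  So [G] is the set of the [f] in [B] with a unique
    maximizer, which is dense by the perturbation principle, and which is the
    intersection over [n] of the open sets of those [f] for which [phi n] varies
    by at most 1 on [near_max f s], for some [s > 0]. *)

(** * Linear functionals below a sublinear one *)

(** Only one inequality is asked for in homogeneity, as this is what infima
    inherit directly; the case of [t^-1] gives the other one. *)
Definition sublinear {R : realType} {V : lmodType R} (q : V -> R) : Prop :=
  (forall x y, q (x + y) <= q x + q y) /\
  (forall t x, 0 < t -> q (t *: x) <= t * q x).

Section sublinear_functionals.
Context {R : realType} {V : lmodType R}.
Implicit Types (p q : V -> R) (u v x y : V).

Lemma sublinearZ q t x : sublinear q -> 0 < t -> q (t *: x) = t * q x.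
Proof.
move=> [_ qZ] t0; apply/eqP; rewrite eq_le qZ//=.
have ti : 0 < t^-1 by rewrite invr_gt0.
have := qZ _ (t *: x) ti.
by rewrite scalerA mulVf ?gt_eqF// scale1r -(ler_pM2l t0) mulrA divff ?gt_eqF// mul1r.
Qed.

Lemma sublinear0 q : sublinear q -> q 0 = 0.
Proof.
move=> hq; have := sublinearZ q 2 0 hq (ltr0Sn _ _).
by rewrite scaler0 => h; lra.
Qed.

Lemma sublinear_opp_ge q x : sublinear q -> - q (- x) <= q x.
Proof.
by move=> hq; have := hq.1 x (- x); rewrite subrr (sublinear0 _ hq); lra.
Qed.

(** Pulled functionals, infima of chains and gauges are all infima of this
    form. *)
Lemma sublinear_inf (A : V -> set R) :
  (forall x, A x !=set0) -> (forall x, has_lbound (A x)) ->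
  (forall x y a b, A x a -> A y b -> exists2 c, A (x + y) c & c <= a + b) ->
  (forall t x a, 0 < t -> A x a -> exists2 c, A (t *: x) c & c <= t * a) ->
  sublinear (fun x => inf (A x)).
Proof.
move=> A0 Alb AD AZ; have infA x a : A x a -> inf (A x) <= a.
  by apply: ge_inf.
split=> [x y|t x t0].
- rewrite -lerBlDr; apply: lb_le_inf => // a Axa.
  rewrite lerBlDr -lerBlDl; apply: lb_le_inf => // b Ayb.
  by rewrite lerBlDl; have [c /infA + cab] := AD _ _ _ _ Axa Ayb; move/le_trans; apply.
- rewrite -ler_pdivrMl//; apply: lb_le_inf => // a Axa.
  rewrite ler_pdivrMl//.
  by have [c /infA + cab] := AZ _ _ _ t0 Axa; move/le_trans; apply.
Qed.

Definition slopes q v x : set R :=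
  [set q (x + t *: v) - t * q v | t in [set t | 0 <= t]].

(** The largest sublinear functional below [q] whose value at [- v] is at most
    [- q v]. *)
Definition pull q v x : R := inf (slopes q v x).

Lemma pull_lbound q v x : sublinear q -> has_lbound (slopes q v x).
Proof.
move=> hq; exists (- q (- x)) => _ [t /= t0 <-].
have [->|tn0] := eqVneq t 0.
  by rewrite scale0r addr0 mul0r subr0 sublinear_opp_ge.
rewrite -(sublinearZ q _ v hq) ?lt_neqAle 1?eq_sym ?tn0//.
by have := hq.1 (x + t *: v) (- x); rewrite addrAC subrr add0r; lra.
Qed.

Lemma pull_le q v x t : sublinear q -> 0 <= t ->
  pull q v x <= q (x + t *: v) - t * q v.
Proof. by move=> hq t0; apply: ge_inf; [exact: pull_lbound|exists t]. Qed.

Lemma pull_le_id q v x : sublinear q -> pull q v x <= q x.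
Proof.
by move=> hq; have := pull_le q v x 0 hq (lexx _); rewrite scale0r mul0r addr0 subr0.
Qed.

Lemma pull_sublinear q v : sublinear q -> sublinear (pull q v).
Proof.
move=> hq; apply: sublinear_inf => [x|x|x y _ _ [s /= s0 <-] [t /= t0 <-]|t x _ t0 [s /= s0 <-]].
- by exists (q (x + 0 *: v) - 0 * q v); exists 0 => /=.
- exact: pull_lbound.
- exists (q (x + y + (s + t) *: v) - (s + t) * q v).
    by exists (s + t) => //=; exact: addr_ge0.
  by rewrite scalerDl addrACA; have := hq.1 (x + s *: v) (y + t *: v); lra.
- exists (q (t *: x + (t * s) *: v) - (t * s) * q v).
    by exists (t * s) => //=; rewrite mulr_ge0// ltW.
  by rewrite -scalerA -scalerDr (sublinearZ _ _ _ hq)// mulrBr mulrA.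
Qed.

(** Minimality of [q] against [pull q y] says that [pull q y] is [q] itself,
    and [pull q y x <= q (x + y) - q y] is then superadditivity. *)
Lemma minimal_sublinear_linear q : sublinear q ->
  (forall q', sublinear q' -> (forall x, q' x <= q x) -> forall x, q x <= q' x) ->
  (forall x y, q (x + y) = q x + q y) /\ (forall t x, q (t *: x) = t * q x).
Proof.
move=> hq qmin.
have qD x y : q (x + y) = q x + q y.
  apply/eqP; rewrite eq_le hq.1 /=.
  have := qmin _ (pull_sublinear q y hq) (fun z => pull_le_id q y z hq) x.
  move/le_trans => /(_ _ (pull_le q y x 1 hq ler01)).
  by rewrite scale1r mul1r lerBrDr.
have qN x : q (- x) = - q x.
  by have := qD x (- x); rewrite subrr sublinear0//; lra.
split=> // t x.
have [t0|t0|->] := ltgtP t 0.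
- rewrite -[t]opprK scaleNr qN sublinearZ ?oppr_gt0//; ring.
- exact: sublinearZ.
- by rewrite scale0r mul0r sublinear0.
Qed.

(** Zorn's lemma applies because [- p (- x)] bounds from below the values at
    [x] of all sublinear functionals below [p]. *)
Lemma minimal_sublinear_exists p : sublinear p ->
  exists q, [/\ sublinear q, forall x, q x <= p x &
    forall q', sublinear q' -> (forall x, q' x <= q x) -> forall x, q x <= q' x].
Proof.
move=> hp; pose T := {q : V -> R | sublinear q /\ forall x, q x <= p x}.
pose below (r s : T) := `[< forall x, sval s x <= sval r x >].
have p_lb x (s : T) : - p (- x) <= sval s x.
  case: s => s [hs sp] /=; have := sublinear_opp_ge _ x hs.
  by apply: le_trans; rewrite lerN2.
have [|||[q [hq qp]] qmax] := @ZL_preorder T (exist _ p (conj hp (fun=> lexx _))) below.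
- by move=> t; apply/asboolP => x.
- move=> r s t /asboolP rs /asboolP st; apply/asboolP => x.
  exact: le_trans (st x) (rs x).
- move=> F Ftot; have [[s0 Fs0]|F0] := pselect (F !=set0); last first.
    by exists (exist _ p (conj hp (fun=> lexx _))) => s Fs; exfalso; apply: F0; exists s.
  pose A x := [set sval s x | s in F].
  have Alb x : has_lbound (A x) by exists (- p (- x)) => _ [s Fs <-]; exact: p_lb.
  have hA : sublinear (fun x => inf (A x)).
    apply: sublinear_inf => // [x|x y _ _ [r Fr <-] [s Fs <-]|t x _ t0 [s Fs <-]].
    + by exists (sval s0 x); exists s0.
    + have [/asboolP rs|/asboolP sr] := Ftot _ _ Fr Fs.
        exists (sval s (x + y)); first by exists s.
        by apply: (le_trans ((svalP s).1.1 x y)); rewrite lerD2r.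
      exists (sval r (x + y)); first by exists r.
      by apply: (le_trans ((svalP r).1.1 x y)); rewrite lerD2l.
    + exists (sval s (t *: x)); first by exists s.
      exact: (svalP s).1.2.
  have Ale s : F s -> forall x, inf (A x) <= sval s x.
    by move=> Fs x; apply: ge_inf => //; exists s.
  have Ap x : inf (A x) <= p x by exact: le_trans (Ale _ Fs0 x) ((svalP s0).2 x).
  by exists (exist _ (fun x => inf (A x)) (conj hA Ap) : T) => s Fs; apply/asboolP; exact: Ale.
- exists q; split=> // q' hq' q'q.
  have q'p x : q' x <= p x by exact: le_trans (q'q x) (qp x).
  have := qmax (exist _ q' (conj hq' q'p)) (introT (asboolP _) q'q).
  by move/asboolP.
Qed.

(** Starting the minimization from [pull p u] instead of [p] forces
    [F (- u) <= - p u], that is, equality at [u]. *)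
Lemma hahn_banach_at p u : sublinear p ->
  exists F : V -> R, [/\ forall x y, F (x + y) = F x + F y,
    forall t x, F (t *: x) = t * F x, forall x, F x <= p x & F u = p u].
Proof.
move=> hp; have hpu := pull_sublinear p u hp.
have [F [hF Fpu Fmin]] := minimal_sublinear_exists _ hpu.
have [FD FZ] := minimal_sublinear_linear _ hF Fmin.
have Fp x : F x <= p x by exact: le_trans (Fpu x) (pull_le_id p u x hp).
exists F; split=> //; apply/eqP; rewrite eq_le Fp/=.
have := le_trans (Fpu (- u)) (pull_le p u (- u) 1 hp ler01).
by rewrite scale1r mul1r addNr sublinear0// sub0r -scaleN1r FZ mulN1r lerN2.
Qed.

End sublinear_functionals.

(** * Separation of points in a locally convex space *)

Definition gauge {R : realType} {V : lmodType R} (U : set V) (x : V) : R :=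
  inf [set r | 0 < r /\ exists2 z, U z & x = r *: z].

Section separation_of_points.
Context {R : realType} {S : tvsType R}.
Implicit Types (U : set S) (x y z : S).

Lemma open_scale_translate U (t : R) x : open U -> U 0 ->
  \forall y \near x, U (t *: (y - x)).
Proof.
move=> Uo U0.
have yx : (y - x @[y --> x]) --> (0 : S).
  rewrite -(subrr x).
  apply: (@cvg_comp _ _ _ (fun y => (y, x)) (fun z : S * S => z.1 - z.2) _ (nbhs (x, x))).
    by apply: cvg_pair => /=; [exact: cvg_id|exact: cvg_cst].
  exact: (@sub_continuous S (x, x)).
have : (t *: (y - x) @[y --> x]) --> (0 : S).
  rewrite -(scaler0 _ t).
  apply: (@cvg_comp _ _ _ (fun y => (t : R^o, y - x)) (fun z : R^o * S => z.1 *: z.2)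
    _ (nbhs ((t : R^o), (0 : S)))).
    by apply: (@cvg_pair _ _ _ _ (nbhs (t : R^o)) (nbhs (0 : S))); [exact: cvg_cst|exact: yx].
  exact: (@scale_continuous R S (t, 0)).
by move=> /(_ U); apply; exact: open_nbhs_nbhs.
Qed.

Lemma convex_set_comb U (l : R) x y : convex_set U -> U x -> U y -> 0 <= l <= 1 ->
  U (l *: x + (1 - l) *: y).
Proof.
move=> Uc Ux Uy /andP[l0 l1].
by have /set_mem := Uc x y (Itv01 l0 l1) (mem_set Ux) (mem_set Uy).
Qed.

Lemma gauge_lbound U x :
  has_lbound [set r : R | 0 < r /\ exists2 z, U z & x = r *: z].
Proof. by exists 0 => r [/ltW]. Qed.

Lemma gauge_le1 U x : U x -> gauge U x <= 1 :> R.
Proof.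
by move=> Ux; apply: ge_inf; [exact: gauge_lbound|split=> //; exists x; rewrite ?scale1r].
Qed.

Lemma gauge_nonempty U x : open U -> U 0 ->
  [set r : R | 0 < r /\ exists2 z, U z & x = r *: z] !=set0.
Proof.
move=> Uo U0.
have /nbhs_ballP[e /= e0 eU] : \forall t \near (0 : R), U (t *: x).
  have h : (t *: x @[t --> (0 : R^o)]) --> (0 : S).
    rewrite -(scale0r x).
    apply: (@cvg_comp _ _ _ (fun t : R^o => (t, x)) (fun z : R^o * S => z.1 *: z.2)
      _ (nbhs ((0 : R^o), x))).
      by apply: (@cvg_pair _ _ _ _ (nbhs (0 : R^o)) (nbhs x)); [exact: cvg_id|exact: cvg_cst].
    exact: (@scale_continuous R S (0, x)).
  by apply: (h U); exact: open_nbhs_nbhs.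
have e2 : 0 < e / 2 by rewrite divr_gt0.
exists (e / 2)^-1; split; first by rewrite invr_gt0.
exists ((e / 2) *: x); last by rewrite scalerA mulVf ?gt_eqF// scale1r.
by apply: eU; rewrite /ball/= sub0r normrN gtr0_norm// ltr_pdivrMr// ltr_pMr// ltr1n.
Qed.

Lemma gauge_sublinear U : open U -> U 0 -> convex_set U ->
  sublinear (gauge U : S -> R).
Proof.
move=> Uo U0 Uc; apply: sublinear_inf.
- by move=> x; exact: gauge_nonempty.
- exact: gauge_lbound.
- move=> x y r s [r0 [z Uz ->]] [s0 [w Uw ->]]; exists (r + s) => //.
  have rs0 : 0 < r + s by exact: addr_gt0.
  split=> //; exists ((r / (r + s)) *: z + (s / (r + s)) *: w); last first.
    rewrite scalerDr !scalerA; congr (_ *: _ + _ *: _).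
      by field; rewrite gt_eqF.
    by field; rewrite gt_eqF.
  have l01 : 0 <= r / (r + s) <= 1.
    by rewrite (divr_ge0 (ltW r0) (ltW rs0)) ler_pdivrMr// mul1r lerDl ltW.
  suff <- : 1 - r / (r + s) = s / (r + s) by exact: convex_set_comb.
  by field; rewrite gt_eqF.
- move=> t x r t0 [r0 [z Uz ->]]; exists (t * r) => //; split.
    exact: mulr_gt0.
  by exists z => //; rewrite scalerA.
Qed.

Lemma gauge_ge1 U x : U 0 -> convex_set U -> ~ U x ->
  [set r : R | 0 < r /\ exists2 z, U z & x = r *: z] !=set0 -> 1 <= gauge U x :> R.
Proof.
move=> U0 Uc Ux A0; apply: lb_le_inf => // r [r0 [z Uz xrz]].
rewrite leNgt; apply/negP => r1; apply: Ux.
have l01 : 0 <= r <= 1 by rewrite !ltW.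
by have := convex_set_comb _ _ _ _ Uc Uz U0 l01; rewrite scaler0 addr0 -xrz.
Qed.

(** Hahn-Banach for the gauge of a convex neighborhood of 0 that misses
    [y - x] gives a functional that is at least 1 there; doubling it makes the
    inequality strict. *)
Lemma continuous_linear_separation x y : hausdorff_space S -> x <> y ->
  exists F : S -> R, [/\ continuous F, forall x y, F (x + y) = F x + F y,
    forall t x, F (t *: x) = t * F x & 1 < F y - F x].
Proof.
move=> hS xy; have yx0 : y - x != 0 by rewrite subr_eq0; apply/eqP => e; exact: xy.
have [U [Uo U0 Uc Uyx]] : exists U : set S,
    [/\ open U, U 0, convex_set U & ~ U (y - x)].
  have [B Bconv [Bo Bbase]] := @locally_convex R S.
  move: yx0; rewrite eq_sym => /(hausdorff_accessible hS)[A [Ao /set_mem A0 /set_mem Ayx]].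
  have [V [BV V0] VA] := Bbase 0 A (open_nbhs_nbhs (conj Ao A0)).
  by exists V; split=> //; [exact: Bo|apply: Bconv; exact: mem_set|move/VA].
have gsub := gauge_sublinear U Uo U0 Uc.
have [F [FD FZ Fg Fyx]] := hahn_banach_at _ (y - x) gsub.
have FB a b : F (a - b) = F a - F b by rewrite FD -scaleN1r FZ mulN1r.
exists (fun z => 2 * F z); split.
- move=> z; apply: cvgM; first exact: cvg_cst.
  apply/cvgrPdist_le => e e0.
  near=> w.
  (* [F <= gauge U <= 1] on [U], which need not be symmetric: the two bounds on
     [F (w - z)] come from the two signs. *)
  have h1 : U (e^-1 *: (w - z)) by near: w; exact: open_scale_translate.
  have h2 : U (- e^-1 *: (w - z)) by near: w; exact: open_scale_translate.
  have := le_trans (Fg _) (gauge_le1 _ _ h1).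
  have := le_trans (Fg _) (gauge_le1 _ _ h2).
  rewrite !FZ FB mulNr -mulrN !ler_pdivrMl// !mulr1 => ha hb.
  by rewrite distrC ler_norml; lra.
- by move=> a b; rewrite FD mulrDr.
- by move=> t a; rewrite FZ; ring.
- rewrite -mulrBr -FB Fyx.
  suff : 1 <= gauge U (y - x) :> R by lra.
  by apply: gauge_ge1 => //; exact: gauge_nonempty.
Unshelve. all: by end_near. Qed.

End separation_of_points.

(** * Upper semicontinuous functions on compact spaces *)

Section near_maximizers.
Context {R : realType} {T : Type}.
Implicit Types (f g : T -> R) (s r : R).

(** Stated without a supremum, so that [s = 0] gives the set of maximizers. *)
Definition near_max f s : set T := [set x | forall y, f y <= f x + s].

Lemma near_max_le f s s' : s <= s' -> near_max f s `<=` near_max f s'.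
Proof. by move=> ss' x fx y; apply: le_trans (fx y) _; rewrite lerD2l. Qed.

Lemma near_max_approx f g s r : (forall x, `|f x - g x| <= r) ->
  near_max g s `<=` near_max f (s + 2 * r).
Proof.
move=> fg x gx y; have := gx y; have := fg x; have := fg y.
by rewrite !ler_norml => /andP[? ?] /andP[? ?]; lra.
Qed.

End near_maximizers.

Section upper_semicontinuous.
Context {R : realType} {T : topologicalType}.
Implicit Types (f : T -> R) (C : set T).

Lemma continuous_usc f : continuous f -> usc f.
Proof. by move=> cf x a fxa; exact: (cvgr_lt _ (cf x)). Qed.

Lemma usc_add f g : usc f -> usc g -> usc (fun x => f x + g x).
Proof.
move=> uf ug x a fga; pose e := (a - f x - g x) / 2.
have fe : f x < f x + e by rewrite /e; lra.
have ge : g x < g x + e by rewrite /e; lra.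
apply: filterS2 (uf _ _ fe) (ug _ _ ge) => y; rewrite /e; lra.
Qed.

Lemma usc_superlevel_closed f a : usc f -> closed [set x | a <= f x].
Proof.
move=> uf; rewrite -[X in closed X]setCK; apply: open_closedC.
rewrite openE => x /= /negP; rewrite -ltNge => /uf.
by apply: filterS => y; rewrite ltNge => /negP.
Qed.

(** The superlevel sets [f x <= f y] with [x] in [C] form a filter base on [C],
    and any of its cluster points is a maximizer. *)
Lemma usc_compact_max f C : usc f -> compact C -> C !=set0 ->
  exists2 x, C x & forall y, C y -> f y <= f x.
Proof.
move=> uf Cc [x0 Cx0]; pose upper x := C `&` [set y | f x <= f y].
have FF : ProperFilter (filter_from C upper).
  apply: filter_from_proper; last by move=> x Cx; exists x; split=> /=.
  apply: filter_from_filter; first by exists x0.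
  move=> x y Cx Cy; have [xy|/ltW yx] := leP (f x) (f y).
    by exists y => // z [Cz /= yz]; do 2?split=> //=; exact: le_trans yz.
  by exists x => // z [Cz /= xz]; do 2?split=> //=; exact: le_trans xz.
have FC : filter_from C upper C by exists x0 => // y [].
have [p [Cp clp]] := Cc _ FF FC; exists p => // y Cy.
rewrite leNgt; apply/negP => /uf pn.
have Fy : filter_from C upper (upper y) by exists y.
by have [z [[_ /= yz] /=]] := clp _ _ Fy pn; rewrite ltNge yz.
Qed.

Lemma usc_compact_gap f C a : usc f -> compact C -> (forall x, C x -> f x < a) ->
  exists2 eta, 0 < eta & forall x, C x -> f x + eta <= a.
Proof.
move=> uf Cc fa; have [C0|C0] := pselect (C !=set0); last first.
  by exists 1 => // x Cx; exfalso; apply: C0; exists x.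
have [m Cm mmax] := usc_compact_max _ _ uf Cc C0.
exists (a - f m); first by rewrite subr_gt0 fa.
by move=> x /mmax; lra.
Qed.

Context (Tc : compact [set: T]).

(** Let [c] be a maximizer of [f] that has the largest [phi].  At every
    near-maximizer of [f + t * phi], the value of [phi] is not much below
    [phi c], since [c] itself competes and [f <= f c]; it is not much above
    either for small [t], since [f] stays away from its maximum where
    [phi >= phi c + 1/2]. *)
Lemma near_max_small_oscillation (f phi : T -> R) (M e : R) (x0 : T) :
  usc f -> continuous phi -> 0 < M -> (forall x, `|phi x| <= M) -> 0 < e ->
  exists2 t, 0 < t /\ t * M <= e & exists2 s, 0 < s &
    forall x y, near_max (fun z => f z + t * phi z) s x ->
      near_max (fun z => f z + t * phi z) s y -> `|phi x - phi y| <= 1.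
Proof.
move=> uf cphi M0 phiM e0.
have [m _ mmax] := usc_compact_max _ _ uf Tc (ex_intro _ x0 I).
have argmax_compact : compact [set x | f m <= f x].
  by apply: subclosed_compact Tc _ => //; exact: usc_superlevel_closed.
have [c /= fmc cmax] := usc_compact_max _ _ (continuous_usc _ cphi) argmax_compact
  (ex_intro _ m (lexx _)).
have [eta eta0 gap] : exists2 eta, 0 < eta &
    forall x, phi c + 2^-1 <= phi x -> f x + eta <= f c.
  apply: (usc_compact_gap f [set x | phi c + 2^-1 <= phi x]) => //.
    by apply: subclosed_compact Tc _ => //; apply: usc_superlevel_closed; exact: continuous_usc.
  move=> x /= cx; rewrite ltNge; apply/negP => fcx.
  by have := cmax x (le_trans fmc fcx); lra.
have fc x : f x <= f c by apply: le_trans fmc; exact: mmax.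
(* [t * phi] must move by less than the gap [eta], and by at most [e]. *)
pose t := Num.min (eta / (8 * M)) (e / M).
have t0 : 0 < t by rewrite lt_min !divr_gt0// mulr_gt0.
have tM1 : t * M <= eta / 8.
  rewrite -ler_pdivlMr// (@le_trans _ _ (eta / (8 * M)))//; first by rewrite ge_min lexx.
  by rewrite invfM mulrA.
have tM2 : t * M <= e by rewrite -ler_pdivlMr// ge_min lexx orbT.
(* [s <= t / 2] turns an error of [s] on [t * phi] into one of 1/2 on [phi]. *)
exists t => //; pose s := Num.min (eta / 4) (t / 2).
have s1 : s <= eta / 4 by rewrite ge_min lexx.
have s2 : s <= t / 2 by rewrite ge_min lexx orbT.
have s0 : 0 < s by rewrite lt_min !divr_gt0.
exists s => //.
have osc x : near_max (fun z => f z + t * phi z) s x ->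
    phi c - 2^-1 <= phi x <= phi c + 2^-1.
  move=> /(_ c) xc; apply/andP; split.
    rewrite -(ler_pM2l t0); have := fc x; lra.
  rewrite leNgt; apply/negP => /ltW /gap xgap.
  have tphi y : `|t * phi y| <= eta / 8.
    by rewrite normrM gtr0_norm// (le_trans _ tM1)// ler_pM2l.
  have := tphi x; have := tphi c; rewrite !ler_norml => /andP[? ?] /andP[? ?]; lra.
by move=> x y /osc /andP[? ?] /osc /andP[? ?]; rewrite ler_norml; lra.
Qed.

(** Where [phi] differs from [phi m] by 1/2 or more, [f] is bounded away from
    its maximum. *)
Lemma unique_max_small_oscillation (f phi : T -> R) (m : T) :
  usc f -> continuous phi -> (forall y, y <> m -> f y < f m) ->
  exists2 s, 0 < s & forall x y, near_max f s x -> near_max f s y ->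
    `|phi x - phi y| <= 1.
Proof.
move=> uf cphi mmax.
have cdist : continuous (fun x => `|phi x - phi m|).
  move=> x; apply: (@continuous_comp _ _ _ (fun x => phi x - phi m) Num.norm).
    by apply: cvgB; [exact: cphi|exact: cvg_cst].
  exact: norm_continuous.
have far : compact [set x | 2^-1 <= `|phi x - phi m|].
  by apply: subclosed_compact Tc _ => //; apply: usc_superlevel_closed; exact: continuous_usc.
have [|eta eta0 gap] := usc_compact_gap _ _ (f m) uf far.
  move=> x /= xm; apply: mmax => xm'; move: xm.
  by rewrite xm' subrr normr0; lra.
have close x : near_max f (eta / 2) x -> `|phi x - phi m| < 2^-1.
  by move=> /(_ m) xm; rewrite ltNge; apply/negP => /gap; move: xm; lra.
exists (eta / 2) => [|x y /close + /close]; first by rewrite divr_gt0.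
by rewrite !ltr_norml ler_norml => /andP[? ?] /andP[? ?]; lra.
Qed.

End upper_semicontinuous.

(** * Continuous affine functions *)

Lemma compact_set_type {T : topologicalType} (A : set T) :
  compact A -> compact [set: A].
Proof.
move=> Ac F FF _.
have FA : (set_val @ F) A.
  rewrite /fmap/= (_ : _ @^-1` _ = setT); first exact: filterT.
  by apply/seteqP; split=> // z _; exact: set_valP.
have [p [Ap clp]] := Ac (set_val @ F) _ FA.
exists (exist _ p (mem_set Ap)); split=> // P U FP [_ [[W Wo <-] Wp WU]].
have FvP : (set_val @ F) (set_val @` P).
  by apply: (@filterS _ F _ P) => // z Pz; exists z.
have [_ [[z Pz <-] Wz]] := clp _ _ FvP (open_nbhs_nbhs (conj Wo Wp)).
by exists z; split=> //; exact: WU.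
Qed.

(** If no finite subfamily covers [C], then the sets left uncovered by finite
    subfamilies form a filter base on [C] without a cluster point. *)
Lemma compact_finite_subcover {T : topologicalType} {I : eqType} (C : set T)
    (O : I -> set T) : compact C -> (forall i, open (O i)) ->
  C `<=` \bigcup_i O i -> exists s : seq I, C `<=` \bigcup_(i in [set` s]) O i.
Proof.
move=> Cc Oo CO; apply: contrapT => noF.
pose uncovered (s : seq I) := C `&` ~` \bigcup_(i in [set` s]) O i.
have FF : ProperFilter (filter_from [set: seq I] uncovered).
  apply: filter_from_proper.
    apply: filter_from_filter; first by exists [::].
    move=> s s' _ _; exists (s ++ s') => // x [Cx nx].
    split; split=> // -[i /= ii Oix]; apply: nx; exists i => //=.
      by rewrite mem_cat ii.
    by rewrite mem_cat ii orbT.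
  move=> s _; apply: contrapT => us; apply: noF; exists s => x Cx.
  by apply: contrapT => nx; apply: us; exists x.
have FC : filter_from [set: seq I] uncovered C by exists [::] => // x [].
have [p [Cp clp]] := Cc _ FF FC; have [i _ Oip] := CO p Cp.
have Fi : filter_from [set: seq I] uncovered (uncovered [:: i]) by exists [:: i].
have [x [[_ nx] Oix]] := clp _ _ Fi (open_nbhs_nbhs (conj (Oo i) Oip)).
by apply: nx; exists i => //=; rewrite inE.
Qed.

Section continuous_affine_functions.
Context {R : realType} {S : tvsType R} {X : set S}.
Implicit Types (u v phi : S -> R) (K : set S).

Lemma Aff_continuous K phi : Aff X phi -> K `<=` X ->
  continuous (phi \o set_val : K -> R).
Proof.
move=> [cphi _] KX; apply/(@subspace_sigL_continuousP _ K).
exact: (continuous_subspaceW KX cphi).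
Qed.

Lemma Aff0 : Aff X (fun=> 0 : R).
Proof.
split; first by apply: continuous_subspaceT => x; exact: cvg_cst.
by move=> x y l _ _ _; rewrite !mulr0 addr0.
Qed.

Lemma AffD u v : Aff X u -> Aff X v -> Aff X (fun x => u x + v x).
Proof.
move=> [cu au] [cv av]; split; first by move=> x; exact: cvgD (cu x) (cv x).
by move=> x y l Xx Xy l01; rewrite au// av//; ring.
Qed.

Lemma AffZ t u : Aff X u -> Aff X (fun x => t * u x).
Proof.
move=> [cu au]; split; first by move=> x; exact: cvgM (cvg_cst _) (cu x).
by move=> x y l Xx Xy l01; rewrite au//; ring.
Qed.

Lemma Aff_uniform_limit u : convex_set X ->
  (forall e, 0 < e -> exists2 v, Aff X v & forall x, X x -> `|u x - v x| <= e) ->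
  Aff X u.
Proof.
move=> Xc uv; split.
  apply/subspace_continuousP => x Xx; apply/cvgrPdist_le => e e0.
  have e3 : 0 < e / 3 by rewrite divr_gt0.
  have [v [/subspace_continuousP cv _] uve] := uv _ e3.
  have /cvgrPdist_le /(_ _ e3) := cv x Xx.
  rewrite !near_withinE; apply: filterS => y vxy Xy.
  have : `|v x - v y| <= e / 3 := vxy Xy.
  suff : `|v x - v y| <= e / 3 -> `|u x - u y| <= e by [].
  have := uve _ Xx; have := uve _ Xy; rewrite !ler_norml.
  by move=> /andP[? ?] /andP[? ?] /andP[? ?]; lra.
move=> x y l Xx Xy l01; apply/eqP; rewrite -subr_eq0 -normr_le0.
apply/ler_addgt0Pr => e e0; rewrite add0r.
have e2 : 0 < e / 2 by rewrite divr_gt0.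
have [v [_ av] uve] := uv _ e2.
have := uve _ (convex_set_comb _ _ _ _ Xc Xx Xy l01); rewrite av//.
case/andP: l01 => l0 l1; have l1' : 0 <= 1 - l by rewrite subr_ge0.
have scaled t z : 0 <= t -> X z -> `|t * (u z - v z)| <= t * (e / 2).
  by move=> t0 /uve uvz; rewrite normrM ger0_norm// ler_wpM2l.
have := scaled _ _ l0 Xx; have := scaled _ _ l1' Xy; rewrite !ler_norml.
by move=> /andP[? ?] /andP[? ?] /andP[? ?]; lra.
Qed.

Lemma Aff_bounded phi : compact X -> Aff X phi ->
  exists2 M, 0 < M & forall x, X x -> `|phi x| <= M.
Proof.
move=> Xc aphi; have [[x0 Xx0]|X0] := pselect (X !=set0); last first.
  by exists 1 => // x Xx; exfalso; apply: X0; exists x.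
have cphi : continuous (fun x : X => `|phi (set_val x)|).
  have cphi := Aff_continuous X phi aphi (@subset_refl _ X).
  by move=> x; apply: (continuous_comp (cphi x)); exact: norm_continuous.
have [m _ mmax] := usc_compact_max _ _ (continuous_usc _ cphi) (compact_set_type _ Xc)
  (ex_intro _ (exist _ x0 (mem_set Xx0)) I).
exists (1 + `|phi (set_val m)|); first by rewrite ltr_wpDr.
move=> x Xx; apply: ler_wpDl => //.
exact: (mmax (exist _ x (mem_set Xx)) I).
Qed.

Lemma Aff_separation x y : hausdorff_space S -> x <> y ->
  exists2 phi, Aff X phi & 1 < phi y - phi x.
Proof.
move=> hS /(continuous_linear_separation _ _ hS)[F [cF FD FZ Fxy]].
exists F => //; split; first exact: continuous_subspaceT.
by move=> a b l _ _ _; rewrite FD !FZ.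
Qed.

(** For each [m], the pairs at distance at least [m.+1%:R^-1] form a compact
    set, which is covered by finitely many of the open sets of pairs separated
    by a given affine function. *)
Lemma Aff_separating_sequence : hausdorff_space S -> compact X -> metrizable R X ->
  exists2 phi : nat -> S -> R, (forall n, Aff X (phi n)) &
    forall x y, X x -> X y -> x <> y -> exists n, 1 < `|phi n x - phi n y|.
Proof.
move=> hS Xc [d [d0 dC dD dball]].
have d_ge0 x y : 0 <= d x y.
  by have := dD x y x; rewrite (dC y x) (d0 x x).2//; lra.
have dusc : usc (fun p : X * X => d p.1 p.2).
  move=> [x y] a /= da; pose e := (a - d x y) / 2.
  have e0 : 0 < e by rewrite /e; lra.
  have dnbhs z : nbhs z [set w | d z w < e] by rewrite dball; exists e.
  exists ([set w | d x w < e], [set w | d y w < e]) => //= -[v w] [/= xv yw].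
  have := dD v x w; have := dD x y w; rewrite (dC v x); move: xv yw; rewrite /e; lra.
have [psi psiP] : {psi : X * X -> S -> R & forall p, Aff X (psi p) /\
    (p.1 <> p.2 -> 1 < psi p (set_val p.2) - psi p (set_val p.1))}.
  apply: (@choice (X * X) (S -> R) (fun p phi => Aff X phi /\
    (p.1 <> p.2 -> 1 < phi (set_val p.2) - phi (set_val p.1)))).
  move=> [x y]; have [->|xy] := pselect (x = y).
    by exists (fun=> 0); split=> //; exact: Aff0.
  have [phi aphi phixy] := Aff_separation (set_val x) (set_val y) hS
    (fun e => xy (val_inj e)).
  by exists phi.
pose O p := [set q : X * X | 1 < psi p (set_val q.2) - psi p (set_val q.1)].
have Oopen p : open (O p).
  have cpsi := Aff_continuous X _ (psiP p).1 (@subset_refl _ X).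
  have cO : continuous (fun q : X * X =>
      psi p (set_val q.2) - psi p (set_val q.1)).
    move=> q; apply: (@cvgB _ _ _ _ _ (fun q : X * X => psi p (set_val q.2))
      (fun q => psi p (set_val q.1))).
      apply: (@cvg_comp _ _ _ (snd : X * X -> X) (psi p \o set_val) _ (nbhs q.2)).
        exact: cvg_snd.
      exact: (cpsi q.2).
    apply: (@cvg_comp _ _ _ (fst : X * X -> X) (psi p \o set_val) _ (nbhs q.1)).
      exact: cvg_fst.
    exact: (cpsi q.1).
  by rewrite openE => q /= Oq; exact: (cvgr_gt _ (cO q)).
pose D m := [set p : X * X | m.+1%:R^-1 <= d p.1 p.2].
have Dc m : compact (D m).
  apply: (@subclosed_compact _ _ [set: X * X]) => //; first exact: usc_superlevel_closed.
  by rewrite -setXTT; apply: compact_setX; exact: compact_set_type.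
have [L LP] : {L : nat -> seq (X * X) & forall m, D m `<=` \bigcup_(p in [set` L m]) O p}.
  suff cover m : exists s : seq (X * X), D m `<=` \bigcup_(p in [set` s]) O p.
    by have [L LP] := choice cover; exists L.
  apply: compact_finite_subcover => //.
  move=> p Dp; exists p => //; apply: (psiP p).2 => e.
  by move: Dp; rewrite /D/= e (d0 _ _).2// leNgt invr_gt0 ltr0n.
(* Entry [k] of the [m]-th finite list, and 0 beyond its end. *)
pose phi n := let: (m, k) := odflt (0, 0)%N (unpickle n : option (nat * nat)) in
  nth (fun=> 0) [seq psi p | p <- L m] k.
exists phi => [n|x y Xx Xy xy].
  rewrite /phi; case: (odflt _ _) => m k.
  elim: (L m) k => [k|p s IHs [|k]]; first by rewrite nth_nil; exact: Aff0.
    exact: (psiP p).1.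
  exact: IHs.
pose p : X * X := (exist _ x (mem_set Xx), exist _ y (mem_set Xy)).
have dp : 0 < d p.1 p.2.
  by rewrite lt_neqAle d_ge0 andbT eq_sym; apply/eqP => /d0 [].
pose m := Num.bound (d p.1 p.2)^-1.
have Dp : D m p.
  rewrite /D/= -[leRHS]invrK lef_pV2 ?posrE ?invr_gt0//.
  have /ltW/le_trans : (d p.1 p.2)^-1 < m%:R by apply: archi_boundP; rewrite invr_ge0.
  by apply; rewrite ler_nat.
have [q /= qL Oqp] := LP m p Dp.
exists (pickle (m, index q (L m))).
rewrite /phi pickleK/= (nth_map p) ?index_mem// nth_index//.
by apply: (lt_le_trans Oqp); rewrite distrC ler_norm.
Qed.

End continuous_affine_functions.

(** * Affine perturbations with a unique maximizer *)

Section perturbed_optimization.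
Context {R : realType} {S : tvsType R} {X : set S}.
Context (Xconvex : convex_set X) (Xcompact : compact X).

(** The intervals of center [v n x] and radius [b n] are nested, and [u x] is
    the supremum of their left ends, which lies in all of them. *)
Lemma Aff_perturbation_limit (v : nat -> S -> R) (b : nat -> R) :
  (forall n, Aff X (v n)) -> (forall n, 0 < b n) -> (forall n, b n.+1 <= b n / 2) ->
  (forall n x, X x -> `|v n.+1 x - v n x| <= b n - b n.+1) ->
  exists2 u, Aff X u & forall n x, X x -> `|u x - v n x| <= b n.
Proof.
move=> av b0 bhalf vb.
pose u x := sup [set v n x - b n | n in [set: nat]].
have lo_hi x n m : X x -> v n x - b n <= v m x + b m.
  move=> Xx; have lo : {homo (fun n => v n x - b n) : i j / (i <= j)%N >-> i <= j}.
    by apply/nondecreasing_seqP => i; have := vb i x Xx; rewrite ler_norml; lra.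
  have hi : {homo (fun n => v n x + b n) : i j / (i <= j)%N >-> j <= i}.
    by apply/nonincreasing_seqP => i; have := vb i x Xx; rewrite ler_norml; lra.
  have := lo n (maxn n m) (leq_maxl _ _); have := hi m (maxn n m) (leq_maxr _ _).
  by have := b0 (maxn n m); rewrite /=; lra.
have uv n x : X x -> `|u x - v n x| <= b n.
  move=> Xx; have lo : v n x - b n <= u x.
    by apply: ub_le_sup; [exists (v n x + b n) => _ [m _ <-]; exact: lo_hi|exists n].
  have hi : u x <= v n x + b n.
    by apply: ge_sup; [exists (v n x - b n); exists n|move=> _ [m _ <-]; exact: lo_hi].
  by rewrite ler_norml; lra.
exists u => //; apply: (Aff_uniform_limit _ Xconvex) => e e0.
(* A slow bound is enough here: the halving of [b] beats [n.+1%:R^-1]. *)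
have bn n : n.+1%:R * b n <= b 0%N.
  elim: n => [|n IHn]; first by rewrite mul1r.
  apply: le_trans IHn; apply: (le_trans (ler_wpM2l _ (bhalf n))) => //.
  have := b0 n; have : 0 <= n%:R :> R by exact: ler0n.
  by rewrite -(@natr1 _ n.+1) -natr1; nra.
pose n := Num.bound (b 0%N / e); exists (v n) => // x Xx.
apply: (le_trans (uv _ _ Xx)); rewrite -(@ler_pM2l _ n.+1%:R)//.
apply: (le_trans (bn n)); rewrite -ler_pdivrMr//.
have /ltW/le_trans : b 0%N / e < n%:R by apply: archi_boundP; rewrite divr_ge0// ltW.
by apply; rewrite ler_nat.
Qed.

(** The number [b] bounds the size of all perturbations still to come.  The
    new bound [wc.2] leaves room for the present one, and is so small that
    later perturbations keep the maximizers inside the near-maximizers obtained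
    here, where [phi] varies by at most 1. *)
Lemma Aff_perturbation_step (K : set S) (f : K -> R) (phi v : S -> R) (b : R) :
  K `<=` X -> compact K -> K !=set0 -> usc f -> Aff X phi -> Aff X v -> 0 < b ->
  exists wc : (S -> R) * R, [/\ Aff X wc.1, 0 < wc.2 <= b / 2,
    forall x, X x -> `|wc.1 x - v x| <= b - wc.2 &
    forall x y, near_max (fun z => f z + wc.1 (set_val z)) (2 * wc.2) x ->
      near_max (fun z => f z + wc.1 (set_val z)) (2 * wc.2) y ->
      `|phi (set_val x) - phi (set_val y)| <= 1].
Proof.
move=> KX Kc [x0 Kx0] uf aphi av b0.
have [M M0 phiM] := Aff_bounded phi Xcompact aphi.
have b2 : 0 < b / 2 by rewrite divr_gt0.
have ufv := usc_add _ _ uf (continuous_usc _ (Aff_continuous K _ av KX)).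
have [t [t0 tM] [s s0 osc]] := near_max_small_oscillation (compact_set_type _ Kc) _
  (phi \o set_val) M (b / 2) (exist _ x0 (mem_set Kx0)) ufv
  (Aff_continuous K _ aphi KX) M0 (fun x => phiM _ (KX _ (set_valP x))) b2.
exists ((fun x => v x + t * phi x), Num.min (b / 2) (s / 2)); split=> /=.
- exact/AffD/AffZ.
- by rewrite lt_min b2 divr_gt0//= ge_min lexx.
- move=> x Xx; rewrite addrAC subrr add0r normrM gtr0_norm//.
  have : t * `|phi x| <= t * M by rewrite ler_pM2l// phiM.
  have : Num.min (b / 2) (s / 2) <= b / 2 by rewrite ge_min lexx.
  by lra.
- have s2 : 2 * Num.min (b / 2) (s / 2) <= s.
    have : Num.min (b / 2) (s / 2) <= s / 2 by rewrite ge_min lexx orbT.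
    by lra.
  under eq_fun do rewrite addrA.
  by move=> x y xs ys; apply: osc; apply: near_max_le s2 _ _.
Qed.

Context (hS : hausdorff_space S) (Xmetrizable : metrizable R X).

(** The steps are iterated over a separating sequence, which leaves a single
    maximizer in the limit. *)
Lemma Aff_unique_max_perturbation (K : set S) (f : K -> R) (e : R) :
  K `<=` X -> compact K -> K !=set0 -> usc f -> 0 < e ->
  exists2 u, Aff X u /\ (forall x, X x -> `|u x| <= e) &
    exists x : K, forall y : K, y <> x -> f y + u (set_val y) < f x + u (set_val x).
Proof.
move=> KX Kc K0 uf e0.
have [phi aphi phisep] := Aff_separating_sequence hS Xcompact Xmetrizable.
pose good n (vb wc : (S -> R) * R) := [/\ Aff X wc.1, 0 < wc.2 <= vb.2 / 2,
    forall x, X x -> `|wc.1 x - vb.1 x| <= vb.2 - wc.2 &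
    forall x y, near_max (fun z => f z + wc.1 (set_val z)) (2 * wc.2) x ->
      near_max (fun z => f z + wc.1 (set_val z)) (2 * wc.2) y ->
      `|phi n (set_val x) - phi n (set_val y)| <= 1].
have step_ex (nvb : nat * ((S -> R) * R)) : exists wc,
    Aff X nvb.2.1 /\ 0 < nvb.2.2 -> good nvb.1 nvb.2 wc.
  case: nvb => n [v b] /=; have [[av b0]|nvb] := pselect (Aff X v /\ 0 < b).
    have [wc wcP] := Aff_perturbation_step K f (phi n) v b KX Kc K0 uf (aphi n) av b0.
    by exists wc.
  by exists (v, b).
have [step stepP] := choice step_ex.
(* The current perturbation, with the bound for all later changes to it. *)
pose st := fix st n := if n is n'.+1 then step (n', st n') else ((fun=> 0) : S -> R, e).
have st_valid n : Aff X (st n).1 /\ 0 < (st n).2.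
  elim: n => [|n IHn] /=; first by split=> //; exact: Aff0.
  by have [? /andP[? _] _ _] := stepP (n, st n) IHn.
have st_good n : good n (st n) (st n.+1) := stepP (n, st n) (st_valid n).
have [u au ust] : exists2 u, Aff X u &
    forall n x, X x -> `|u x - (st n).1 x| <= (st n).2.
  apply: Aff_perturbation_limit => n.
  - exact: (st_valid n).1.
  - exact: (st_valid n).2.
  - by have [_ /andP[]] := st_good n.
  - by have [_ _ ] := st_good n.
exists u; first by split=> // x /(ust 0); rewrite /= subr0.
pose g (z : K) := f z + u (set_val z).
have ug : usc g := usc_add _ _ uf (continuous_usc _ (Aff_continuous K _ au KX)).
have [x0 Kx0] := K0.
have [m _ mmax] := usc_compact_max _ _ ug (compact_set_type _ Kc)
  (ex_intro _ (exist _ x0 (mem_set Kx0)) I).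
have near_st n (z : K) : (forall y, g y <= g z) ->
    near_max (fun z => f z + (st n).1 (set_val z)) (2 * (st n).2) z.
  move=> zmax; rewrite -[2 * _]add0r.
  apply: (near_max_approx _ g) => [x|y]; last by rewrite addr0.
  rewrite /g opprD addrACA subrr add0r distrC.
  exact: ust _ _ (KX _ (set_valP x)).
exists m => y ym; rewrite ltNge; apply/negP => gmy.
have ymax z : g z <= g y by apply: le_trans gmy; exact: mmax.
have [n] := phisep _ _ (KX _ (set_valP y)) (KX _ (set_valP m)) (fun h => ym (val_inj h)).
rewrite ltNge => /negP; apply; have [_ _ _] := st_good n; apply.
- exact: near_st.
- by apply: near_st => z; exact: mmax.
Qed.

End perturbed_optimization.

(** * Exposed points and sets of maximizers *)

Lemma rho_inf_lt_dist {T : Type} {R : realType} (f g : rho_fun T R) (r : R) (x : T) :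
  r <= 2^-1 -> rho_inf f g < r -> `|f x - g x| <= 2 * r.
Proof.
move=> r2 fgr; have := le_lt_trans (rho_inf_ub f g x) fgr.
have := normr_ge0 (f x - g x); set t := `|_| => t0.
by rewrite ltr_pdivrMr ?ltr_wpDr// => tr; nra.
Qed.

Lemma rho_inf_le {T : Type} {R : realType} (f g : rho_fun T R) (r : R) (x0 : T) :
  (forall x, `|f x - g x| <= r) -> rho_inf f g <= r.
Proof.
move=> fgr; apply: ge_sup; first by eexists; exists x0.
move=> _ [x _ <-]; apply: le_trans (fgr x).
by rewrite ler_pdivrMr ?ltr_wpDr// mulrDr mulr1 lerDl mulr_ge0.
Qed.

Lemma KmaxE {R : realType} {S : Type} {K : set S} (f : K -> R) (x : K) :
  Kmax f (set_val x) <-> forall y, f y <= f x.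
Proof. by split=> [[x' x'max /val_inj <-]//|xmax]; exists x. Qed.

Lemma bigcap_KmaxE {R : realType} {S I : Type} {K : set S} (f : I -> K -> R) :
  inhabited I -> \bigcap_i Kmax (f i) = set_val @` [set x : K | forall i y, f i y <= f i x].
Proof.
move=> [i0]; apply/seteqP; split=> [z zmax|_ [x xmax <-] i _].
  have [x _ xz] := zmax i0 Logic.I; exists x => // i.
  by apply/KmaxE; rewrite xz; exact: zmax.
by apply/KmaxE; exact: xmax.
Qed.

Lemma bigcap_Kmax_compact {R : realType} {S : topologicalType} {I : Type} {K : set S}
    (f : I -> K -> R) : inhabited I -> compact K -> (forall i, usc (f i)) ->
  compact (\bigcap_i Kmax (f i)).
Proof.
move=> I0 Kc uf; rewrite bigcap_KmaxE//; apply: continuous_compact.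
  by apply: continuous_subspaceT; exact: initial_continuous.
apply: subclosed_compact (compact_set_type _ Kc) _ => //.
rewrite (_ : [set _ | _] = \bigcap_i \bigcap_y [set x | f i y <= f i x]).
  by apply: closed_bigI => i _; apply: closed_bigI => y _; exact: usc_superlevel_closed.
by apply/seteqP; split=> x xmax i; [move=> _ y _|move=> y]; exact: xmax.
Qed.

Lemma AExp_sub_Ext {R : realType} {S : tvsType R} (X C : set S) :
  C `<=` X -> AExp X C `<=` Ext C.
Proof.
move=> CX x [Cx [phi [_ aphi] phimax]]; split=> // y z a Cy Cz /andP[a0 a1] xE.
have a01 : 0 <= a <= 1 by rewrite !ltW.
have := aphi y z a (CX _ Cy) (CX _ Cz) a01; rewrite -xE => phix.
have phi_le w : C w -> phi w <= phi x.
  by move=> Cw; have [->//|/phimax h] := pselect (w = x); exact/ltW/h.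
have := phi_le y Cy; have := phi_le z Cz => zx yx.
have xy : x = y.
  by apply: contrapT => xy; have := phimax y Cy (fun e => xy (esym e)); nra.
have xz : x = z.
  by apply: contrapT => xz; have := phimax z Cz (fun e => xz (esym e)); nra.
by rewrite -xy -xz.
Qed.

(** If [e] is a proper convex combination of [y] and [z] in [K], then it is
    between them, because an affine function that is at most its value at [e]
    on both of them is constant on the three.  Convexity of the [f i] relative
    to [Aff X] makes [y] and [z] common maximizers, and an exposed point is
    extremal among these. *)
Lemma AExp_bigcap_Kmax_Ext {R : realType} {S : tvsType R} {I : Type} (X K : set S)
    (f : I -> K -> R) : K `<=` X -> inhabited I -> (forall i, Aff_convex X (f i)) ->
  AExp X (\bigcap_i Kmax (f i)) `<=` Ext K.
Proof.
move=> KX I0 cf; have MX : \bigcap_i Kmax (f i) `<=` X.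
  by rewrite bigcap_KmaxE// => _ [x _ <-]; exact: KX (set_valP x).
move=> e /(AExp_sub_Ext _ _ MX); rewrite bigcap_KmaxE//.
move=> [[x xmax <-] xext]; split; first exact: set_valP.
move=> y' z' a Ky Kz a01 xE.
pose y : K := exist _ y' (mem_set Ky); pose z : K := exist _ z' (mem_set Kz).
have between : Aff_between X (set_val x) (set_val y) (set_val z).
  move=> phi [_ aphi] /= yx zx; have /andP[a0 a1] := a01.
  have a01' : 0 <= a <= 1 by rewrite !ltW.
  have := aphi y' z' a (KX _ Ky) (KX _ Kz) a01'; rewrite -xE => phix.
  by split; nra.
have fE i : f i y = f i x /\ f i z = f i x.
  by have [] := cf i x y z between (xmax i y) (xmax i z) => -> ->.
apply: (xext y' z' a) => //.
- by exists y => // i w; rewrite (fE i).1.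
- by exists z => // i w; rewrite (fE i).2.
Qed.

Section exposed_points.
Context {R : realType} {S : tvsType R} {X : set S}.
Context (hS : hausdorff_space S) (Xconvex : convex_set X) (Xcompact : compact X)
  (Xmetrizable : metrizable R X).

(** If [phi + u] with [u] small has a unique maximizer on [C], then [phi + u]
    exposes it, and [phi] is nearly maximal there. *)
Lemma AExp_near_max (C : set S) (phi : S -> R) (e : R) :
  C `<=` X -> compact C -> C !=set0 -> Aff X phi -> 0 < e ->
  exists2 p, AExp X C p & forall x, C x -> phi x <= phi p + e.
Proof.
move=> CX Cc C0 aphi e0; have e2 : 0 < e / 2 by rewrite divr_gt0.
have [u [au ue] [p pmax]] := Aff_unique_max_perturbation Xconvex Xcompact hS Xmetrizable
  C _ _ CX Cc C0 (continuous_usc _ (Aff_continuous C _ aphi CX)) e2.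
have Cp : C (set_val p) := set_valP p.
exists (set_val p) => [|x Cx].
  split=> //; exists (fun x => phi x + u x); first exact: AffD.
  move=> x Cx xp; apply: (pmax (exist _ x (mem_set Cx))) => xp'.
  by apply: xp; rewrite -xp'.
have [xp|xp] := pselect ((exist _ x (mem_set Cx) : C) = p).
  by rewrite -xp lerDl ltW.
have := pmax _ xp; have := ue _ (CX _ Cx); have := ue _ (CX _ Cp).
by rewrite /= !ler_norml => /andP[? ?] /andP[? ?] ?; lra.
Qed.

(** Were [y] a second maximizer besides the extremal [m], then an exposed point
    of [Kmax f] nearly maximizing some affine [phi] with [phi m + 1 < phi y]
    would be an extremal maximizer different from [m]. *)
Lemma Kmax_Ext_singletonP (K : set S) (f : K -> R) :
  K `<=` X -> compact K -> usc f -> Aff_convex X f ->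
  (exists e, Kmax f `&` Ext K = [set e]) <->
  exists m, forall y, y <> m -> f y < f m.
Proof.
move=> KX Kc uf cf.
have KmaxI : \bigcap_(_ in [set: unit]) Kmax f = Kmax f.
  by rewrite bigcap_const//; exists tt.
have MX : Kmax f `<=` X by move=> _ [x _ <-]; exact: KX (set_valP x).
have Mc : compact (Kmax f).
  by rewrite -KmaxI; exact: (bigcap_Kmax_compact (fun _ : unit => f) (inhabits tt)).
have expM : AExp X (Kmax f) `<=` Ext K.
  by rewrite -KmaxI; exact: (AExp_bigcap_Kmax_Ext _ _ (fun _ : unit => f) KX (inhabits tt)).
split=> [[e eE]|[m mmax]].
  have [[m mmax me] _] : (Kmax f `&` Ext K) e by rewrite eE.
  exists m => y ym; rewrite ltNge; apply/negP => fmy.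
  have My : Kmax f (set_val y) by apply/KmaxE => z; exact: le_trans (mmax z) fmy.
  have [phi aphi phimy] := @Aff_separation _ _ X _ _ hS (fun h => ym (esym (val_inj h))).
  have [p pexp pmax] := AExp_near_max _ phi 1 MX Mc (ex_intro _ _ My) aphi ltr01.
  have : [set e] p by rewrite -eE; split; [exact: pexp.1|exact: expM].
  move=> /= pe; have := pmax _ My; rewrite pe -me.
  by move: phimy; rewrite set_valE; lra.
have MmE : Kmax f = [set set_val m].
  apply/seteqP; split=> [_ [x xmax <-]|_ ->] /=.
    have [->//|/mmax] := pselect (x = m).
    by rewrite ltNge xmax.
  by apply/KmaxE => y; have [->//|/mmax/ltW] := pselect (y = m).
exists (set_val m); rewrite MmE; apply/setIidPl => _ ->; apply: expM.
have M0 : Kmax f !=set0 by rewrite MmE; exists (set_val m).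
have [p pexp _] := AExp_near_max _ (fun=> 0) 1 MX Mc M0 Aff0 ltr01.
have pm : p = set_val m by have := pexp.1; rewrite {1}MmE.
by rewrite -pm.
Qed.

End exposed_points.

(** * Genericity of a unique extremal maximizer *)

Lemma near_max_oscillation_open {R : realType} {T : Type} (B : set (rho_fun T R))
    (phi : T -> R) :
  open [set f : B | exists2 s, 0 < s & forall x y,
    near_max (set_val f : T -> R) s x -> near_max (set_val f : T -> R) s y -> `|phi x - phi y| <= 1].
Proof.
rewrite openE => f [s s0 osc]; pose r := Num.min 2^-1 (s / 8).
have r0 : 0 < r by rewrite lt_min invr_gt0 divr_gt0 ?ltr0n.
have r2 : r <= 2^-1 by rewrite ge_min lexx.
have rs : r <= s / 8 by rewrite ge_min lexx orbT.
have fr : \forall g \near f, rho_inf (set_val f) (set_val g) < r.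
  have := @initial_continuous _ _ (set_val : B -> rho_fun T R) f.
  by move=> /(_ (ball (set_val f) r)); apply; exact: nbhsx_ballx.
apply: filterS fr => g fgr; exists (s / 2); first by rewrite divr_gt0.
have gf : near_max (set_val g : T -> R) (s / 2) `<=` near_max (set_val f : T -> R) s.
  move=> x /(near_max_approx (set_val f : T -> R) _ _ (2 * r)) xf.
  apply: (near_max_le _ (s / 2 + 2 * (2 * r))); first by lra.
  by apply: xf => y; exact: rho_inf_lt_dist.
by move=> x y /gf xf /gf yf; exact: osc.
Qed.

Theorem corollary2 (R : realType) (S : tvsType R) (X K : set S)
    (hS : hausdorff_space S)
    (X0 : X !=set0) (Xconvex : convex_set X) (Xcompact : compact X)
    (Xmetrizable : metrizable R X)
    (K0 : K !=set0) (KX : K `<=` X) (Kclosed : closed K) :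
  [/\ (* (1) *)
      AExp X K !=set0 /\ AExp X K `<=` Ext K,
      (* (2) *)
      forall (I : Type) (f : I -> K -> R),
        inhabited I ->
        (forall i, usc (f i)) ->
        (forall i, Aff_convex X (f i)) ->
        \bigcap_(i in [set: I]) Kmax (f i) !=set0 ->
        AExp X (\bigcap_(i in [set: I]) Kmax (f i)) `&` Ext K !=set0 /\
        (exists2 e, Ext K e & forall i, Kmax (f i) e) &
      (* (3) *)
      forall B : set (rho_fun K R),
        (forall f, B f -> usc f /\ Aff_convex X f) ->
        (forall f phi, B f -> Aff X phi ->
           B (fun x : K => f x + phi (set_val x))) ->
        let G : set B :=
          [set f : B | exists e, Kmax (set_val f) `&` Ext K = [set e]] in
        Gdelta G /\ dense G].
Proof.
have Kc : compact K := subclosed_compact Kclosed Xcompact KX.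
have AExp0 C : C `<=` X -> compact C -> C !=set0 -> AExp X C !=set0.
  move=> CX Cc C0.
  have [p pexp _] := AExp_near_max hS Xconvex Xcompact Xmetrizable _ (fun=> 0) 1
    CX Cc C0 Aff0 ltr01.
  by exists p.
split.
- by split; [exact: AExp0|exact: AExp_sub_Ext].
- move=> I f I0 uf cf M0.
  have MX : \bigcap_i Kmax (f i) `<=` X.
    by rewrite bigcap_KmaxE// => _ [x _ <-]; exact: KX (set_valP x).
  have [e eexp] := AExp0 _ MX (bigcap_Kmax_compact _ I0 Kc uf) M0.
  have eext := AExp_bigcap_Kmax_Ext _ _ _ KX I0 cf _ eexp.
  by split; [exists e|exists e => // i; exact: eexp.1].
move=> B Bf BD G.
have GP (f : B) : G f <-> exists m, forall y, y <> m -> (set_val f : K -> R) y < set_val f m.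
  have [uf cf] := Bf _ (set_valP f).
  exact: (Kmax_Ext_singletonP hS Xconvex Xcompact Xmetrizable _ _ KX Kc uf cf).
split.
- have [phi aphi phisep] := Aff_separating_sequence hS Xcompact Xmetrizable.
  exists (fun n => [set f : B | exists2 s, 0 < s & forall x y : K,
    near_max (set_val f : K -> R) s x -> near_max (set_val f : K -> R) s y ->
    `|phi n (set_val x) - phi n (set_val y)| <= 1]).
    by move=> n; exact: near_max_oscillation_open.
  apply/seteqP; split=> [f /GP[m mmax] n _|f fosc].
  + have [uf _] := Bf _ (set_valP f).
    exact: unique_max_small_oscillation (compact_set_type _ Kc) _ (phi n \o set_val) _ uf
      (Aff_continuous K _ (aphi n) KX) mmax.
  + have [uf _] := Bf _ (set_valP f).
    have [k0 Kk0] := K0.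
    have [m _ mmax] := usc_compact_max _ _ uf (compact_set_type _ Kc)
      (ex_intro _ (exist _ k0 (mem_set Kk0)) Logic.I).
    apply/GP; exists m => y ym; rewrite ltNge; apply/negP => fmy.
    have [n] := phisep _ _ (KX _ (set_valP y)) (KX _ (set_valP m)) (fun h => ym (val_inj h)).
    rewrite ltNge => /negP; apply; have [s s0 osc] := fosc n Logic.I.
    apply: osc => z; apply: ler_wpDr (ltW s0) _.
      exact: le_trans (mmax z Logic.I) fmy.
    exact: mmax z Logic.I.
- move=> O [f Of] Oo; have [uf _] := Bf _ (set_valP f).
  have [k0 Kk0] := K0.
  have [W [r /= r0 rW] WO] : exists2 W : set (rho_fun K R), (exists2 r : R, 0 < r &
      ball (set_val f : rho_fun K R) r `<=` W) & set_val @^-1` W `<=` O.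
    case: Oo => W Wo WO; exists W; last by rewrite WO.
    have : nbhs (set_val f : rho_fun K R) W.
      by apply: open_nbhs_nbhs; split=> //; move: Of; rewrite -WO.
    by move=> /nbhs_ballP[r r0 rW]; exists r.
  have r2 : 0 < r / 2 by rewrite divr_gt0.
  have [u [au ur] [m mmax]] := Aff_unique_max_perturbation Xconvex Xcompact hS
    Xmetrizable K _ _ KX Kc K0 uf r2.
  have Bfu := BD _ _ (set_valP f) au.
  exists (exist (fun g => g \in B) _ (mem_set Bfu)); split; last by apply/GP; exists m.
  apply: WO; apply: rW; rewrite /ball/=.
  apply: (@le_lt_trans _ _ (r / 2)); last by rewrite ltr_pdivrMr// ltr_pMr// ltr1n.
  apply: (rho_inf_le _ _ _ (exist _ k0 (mem_set Kk0) : K)) => x.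
  by rewrite opprD addNKr normrN; exact: ur _ (KX _ (set_valP x)).
Qed.
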